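(* If all of the series below converge, then $$\left(x+\tfrac{y-1}{2}\right){}_{5}F_{4}\!\left[\begin{matrix}x,\,x,\,x,\,x+\frac{y+1}{2},\,1\\ x+y,\,x+y,\,x+y,\,x+\frac{y-1}{2}\end{matrix}\,\Bigg|\,-1\right]=x+\tfrac{y-1}{2}-\frac{x^3}{(x+y)^3}\left(x+1+\tfrac{y-1}{2}\right){}_{5}F_{4}\!\left[\begin{matrix}x+1,\,x+1,\,x+1,\,x+1+\frac{y+1}{2},\,1\\ x+1+y,\,x+1+y,\,x+1+y,\,x+1+\frac{y-1}{2}\end{matrix}\,\Bigg|\,-1\right]$$ and $$\left(x+\tfrac{y-1}{2}\right){}_{5}F_{4}\!\left[\begin{matrix}x,\,x,\,x,\,x+\frac{y+1}{2},\,1\\ x+y,\,x+y,\,x+y,\,x+\frac{y-1}{2}\end{matrix}\,\Bigg|\,-1\right]=\tfrac{x-1}{2}+y-\frac{y^3}{(x+y)^3}\left(x+\tfrac{y}{2}\right){}_{5}F_{4}\!\left[\begin{matrix}x,\,x,\,x,\,x+\frac{y+2}{2},\,1\\ x+y+1,\,x+y+1,\,x+y+1,\,x+\frac{y}{2}\end{matrix}\,\Bigg|\,-1\right].$$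
   Context: ${}_{p}F_{q}\!\left[\begin{matrix}a_1,\dots,a_p\\ b_1,\dots,b_q\end{matrix}\,\Big|\,z\right]=\sum_{k=0}^{\infty}\frac{(a_1)_k\cdots(a_p)_k}{(b_1)_k\cdots(b_q)_k}\frac{z^k}{k!}$ is the generalized hypergeometric series, where $(a)_k=a(a+1)\cdots(a+k-1)$. *)

(* Defs.v *)
From HB Require Import structures.
From mathcomp Require Import all_boot all_order all_algebra.
From mathcomp Require Import complex.
From mathcomp Require Import all_classical all_reals all_analysis.

Set Implicit Arguments.
Unset Strict Implicit.
Unset Printing Implicit Defensive.

Import GRing.Theory Num.Theory numFieldNormedType.Exports.
Local Open Scope classical_set_scope.
Local Open Scope ring_scope.

Definition pochhammer (K : numFieldType) (a : K) (n : nat) : K :=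
  \prod_(i < n) (a + i%:R).

Definition hyper_term (K : numFieldType) (a b : seq K) (z : K) (k : nat) : K :=
  (\prod_(c <- a) pochhammer c k) / (\prod_(c <- b) pochhammer c k)
  * (z ^+ k / k`!%:R).

(* Division by 0 is total here, so the nonvanishing of all the denominators,
   i.e. no lower parameter is 0, -1, -2, ..., is part of the meaning of
   "the series converges". *)
Definition hyper_cvg (K : numFieldType) (a b : seq K) (z : K) : Prop :=
  (forall c, c \in b -> forall n, pochhammer c n != 0) /\
  cvgn (series (hyper_term a b z)).

(* The value is meaningful only when hyper_cvg a b z holds. *)
Definition hyperF (K : numFieldType) (a b : seq K) (z : K) : K :=
  limn (series (hyper_term a b z)).

(* Main.v *)
(** Write [c = x + (y - 1) / 2], [z = x + y] and [r k = (x)_k / (z)_k].  The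
    parameters [c + 1] over [c] contribute the factor [(c + k) / c], so [c] times
    the left-hand series is [S(x, y) = \sum_k (-1)^k (r k)^3 (c + k)].
    The first identity splits off the term [k = 0].  For the second, put
    [G k = (-1)^k (r k)^3 ((x + k - 1) / 2 + y)]; the [k]-th terms of [S(x, y)]
    and [y^3 / z^3 S(x, y + 1)] add up to [G k - G (k + 1)], and [G] tends to
    [0] because the terms of [S(x, y)] do and [G k] is [1/2 + O(1/k)] times
    them. *)
Require Import Defs.
From HB Require Import structures.
From mathcomp Require Import all_boot all_order all_algebra.
From mathcomp Require Import complex.
From mathcomp Require Import all_classical all_reals all_analysis.
From mathcomp Require Import ring.
Import Order.TTheory GRing.Theory Num.Theory numFieldNormedType.Exports.
Local Open Scope classical_set_scope.
Local Open Scope ring_scope.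

Lemma pochhammer0 {K : numFieldType} (a : K) : pochhammer a 0 = 1.
Proof. by rewrite /pochhammer big_ord0. Qed.

Lemma pochhammerS {K : numFieldType} (a : K) n :
  pochhammer a n.+1 = pochhammer a n * (a + n%:R).
Proof. by rewrite /pochhammer big_ord_recr. Qed.

Lemma pochhammerSl {K : numFieldType} (a : K) n :
  pochhammer a n.+1 = a * pochhammer (a + 1) n.
Proof.
rewrite /pochhammer big_ord_recl addr0; congr (_ * _).
by apply: eq_bigr => i _; rewrite lift0 -addrA nat1r.
Qed.

Lemma pochhammer1 {K : numFieldType} n : pochhammer (1 : K) n = n`!%:R.
Proof.
elim: n => [|n IHn]; first by rewrite pochhammer0.
by rewrite pochhammerS IHn factS nat1r -natrM mulnC.
Qed.

Lemma pochhammer_neq0 {K : numFieldType} (a : K) :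
  (forall n, pochhammer a n != 0) -> forall n, a + n%:R != 0.
Proof.
by move=> a0 n; have := a0 n.+1; rewrite pochhammerS mulf_eq0 => /norP[].
Qed.

(** [c] stays independent of [x] and [z], so that the telescoping remainder is an instance too. All
    three series have [2 c = x + z - 1], the very-well-poised case. *)
Definition wp_term {K : numFieldType} (x z c : K) (k : nat) : K :=
  (-1) ^+ k * (pochhammer x k / pochhammer z k) ^+ 3 * (c + k%:R).

(** The upper parameter [1] cancels [k!], and [c (c + 1)_k = (c)_k (c + k)]. *)
Lemma wp_termE {K : numFieldType} (x z c : K) k :
    (forall n, pochhammer z n != 0) -> (forall n, pochhammer c n != 0) ->
  c * hyper_term [:: x; x; x; c + 1; 1] [:: z; z; z; c] (-1) k
  = wp_term x z c k.
Proof.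
move=> z0 c0; rewrite /hyper_term /wp_term !big_cons !big_nil pochhammer1.
have := pochhammerS c k; rewrite pochhammerSl => e.
have k0 : k`!%:R != 0 :> K by rewrite pnatr_eq0 -lt0n fact_gt0.
move: (z0 k) (c0 k) => zk ck.
transitivity ((-1) ^+ k * (pochhammer x k / pochhammer z k) ^+ 3
  * ((c * pochhammer (c + 1) k) / pochhammer c k)).
  by field; rewrite k0 zk ck.
by rewrite e; field; rewrite zk ck.
Qed.

(** [c1] is separate from [c + 1] so that parameters such as [x + (y + 1) / 2] match as written. *)
Lemma cvg_series_wp_term {K : numFieldType} (x z c c1 : K) :
    c1 = c + 1 ->
    hyper_cvg [:: x; x; x; c1; 1] [:: z; z; z; c] (-1) ->
  series (wp_term x z c) @ \oo -->
    c * hyperF [:: x; x; x; c1; 1] [:: z; z; z; c] (-1).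
Proof.
move=> -> [nz cv].
have -> : series (wp_term x z c) = (fun n => c *
    series (hyper_term [:: x; x; x; c + 1; 1] [:: z; z; z; c] (-1)) n).
  apply/funext => n; rewrite /series /= big_distrr /=; apply: eq_bigr => k _.
  by rewrite wp_termE //; apply: nz; rewrite !inE eqxx ?orbT.
exact: cvgMl_tmp.
Qed.

(** By [(a)_(k+1) = a (a + 1)_k], each later term is a shifted term times [- x^3 / z^3], the sign
    coming from [(-1)^(k+1)]. *)
Lemma series_wp_termS {K : numFieldType} (x z c : K) n :
  series (wp_term x z c) n.+1
  = c - x ^+ 3 / z ^+ 3 * series (wp_term (x + 1) (z + 1) (c + 1)) n.
Proof.
rewrite /series /= big_nat_recl // big_distrr /= -sumrN; congr (_ + _).
  by rewrite /wp_term !pochhammer0 divr1 expr1n !mul1r addr0.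
apply: eq_bigr => k _; rewrite /wp_term !pochhammerSl (exprS _ k) -(nat1r k) invfM.
by rewrite !exprMn exprVn; ring.
Qed.

(* [G n] is half of [wp_term] with last parameter [x - 1 + 2 y]. *)
Lemma series_wp_term_telescope {K : numFieldType} (x y : K) n :
    (forall n, pochhammer (x + y) n != 0) ->
  series (wp_term x (x + y) (x + (y - 1) / 2)) n
  + y ^+ 3 / (x + y) ^+ 3 * series (wp_term x (x + y + 1) (x + y / 2)) n
  = (x - 1) / 2 + y - wp_term x (x + y) (x - 1 + y *+ 2) n / 2.
Proof.
move=> nz; have xy0 := pochhammer_neq0 _ nz.
have z0 : x + y != 0 by have := xy0 0%N; rewrite addr0.
elim: n => [|n IHn].
  by rewrite /series /= !big_geq // /wp_term !pochhammer0 divr1; field.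
rewrite !seriesSr mulrDr addrACA IHn.
(* With [(x + y + 1)_n] expressed through [(x + y)_n], the induction step becomes a rational
   identity. *)
have e : pochhammer (x + y + 1) n =
    pochhammer (x + y) n * (x + y + n%:R) / (x + y).
  by rewrite -pochhammerS pochhammerSl mulrC mulKf.
rewrite /wp_term e !pochhammerS (exprS _ n) -(nat1r n).
move: (nz n) (xy0 n) => pn xyn.
by field; rewrite pn xyn z0.
Qed.

(* The Archimedean property is a hypothesis because MathComp's archimedean
   structures have no instance on [R[i]]. *)
Lemma cvg_addnV {K : numFieldType} (c : K) :
    (forall z : K, exists N, `|z| < N%:R) ->
  ((c + n%:R)^-1 @[n --> \oo] --> (0 : K)).
Proof.
move=> archi; apply/cvgr0Pnorm_lt => e e0.
(* For [n >= N] the triangle inequality gives [|c + n| >= n - |c| > e^-1]. *)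
have [N] := archi (`|c| + `|e^-1|).
rewrite ger0_norm ?addr_ge0 // => ltN.
exists N => // n /= Nn.
have lt : e^-1 < `|c + n%:R|.
  rewrite -[e^-1]ger0_norm ?invr_ge0 ?ltW //.
  rewrite -(ltrD2l `|c|) (lt_le_trans ltN) //.
  rewrite (@le_trans _ _ n%:R) ?ler_nat // -{1}(normr_nat _ n).
  by rewrite -{1}(addKr c n%:R) (le_trans (ler_normD _ _)) // normrN.
rewrite normfV -[ltRHS]invrK ltf_pV2 // posrE ?invr_gt0 //.
by rewrite (lt_trans _ lt) ?invr_gt0.
Qed.

(** The terms differ by the factor [(c' + n) / (c + n) = 1 + (c' - c) / (c + n)], which tends to
    [1]. *)
Lemma wp_term_cvg0 {K : numFieldType} (x z c c' : K) :
    (forall z : K, exists N, `|z| < N%:R) ->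
    (forall n, c + n%:R != 0) ->
    (wp_term x z c @ \oo --> (0 : K)) ->
  (wp_term x z c' @ \oo --> (0 : K)).
Proof.
move=> archi c0 cv.
have -> : wp_term x z c' =
    (fun n => wp_term x z c n * (1 + (c' - c) * (c + n%:R)^-1)).
  apply/funext => n; rewrite /wp_term.
  by move: (_ / _) (c0 n) => r cn; field.
rewrite -(mul0r (1 + (c' - c) * 0)).
apply: cvgM => //; apply: cvgD; first exact: cvg_cst.
by apply: cvgMl_tmp; exact: cvg_addnV.
Qed.

Lemma contiguous_5F4 {K : numFieldType} (x y : K)
  (archi : forall z : K, exists N, `|z| < N%:R)
  (cvg1 : hyper_cvg
     [:: x; x; x; x + (y + 1) / 2; 1]
     [:: x + y; x + y; x + y; x + (y - 1) / 2] (-1))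
  (cvg2 : hyper_cvg
     [:: x + 1; x + 1; x + 1; x + 1 + (y + 1) / 2; 1]
     [:: x + 1 + y; x + 1 + y; x + 1 + y; x + 1 + (y - 1) / 2] (-1))
  (cvg3 : hyper_cvg
     [:: x; x; x; x + (y + 2) / 2; 1]
     [:: x + y + 1; x + y + 1; x + y + 1; x + y / 2] (-1)) :
  (x + (y - 1) / 2)
    * hyperF [:: x; x; x; x + (y + 1) / 2; 1]
             [:: x + y; x + y; x + y; x + (y - 1) / 2] (-1)
  = x + (y - 1) / 2
    - x ^+ 3 / (x + y) ^+ 3 * (x + 1 + (y - 1) / 2)
      * hyperF [:: x + 1; x + 1; x + 1; x + 1 + (y + 1) / 2; 1]
               [:: x + 1 + y; x + 1 + y; x + 1 + y; x + 1 + (y - 1) / 2] (-1)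
  /\
  (x + (y - 1) / 2)
    * hyperF [:: x; x; x; x + (y + 1) / 2; 1]
             [:: x + y; x + y; x + y; x + (y - 1) / 2] (-1)
  = (x - 1) / 2 + y
    - y ^+ 3 / (x + y) ^+ 3 * (x + y / 2)
      * hyperF [:: x; x; x; x + (y + 2) / 2; 1]
               [:: x + y + 1; x + y + 1; x + y + 1; x + y / 2] (-1).
Proof.
have S1 := cvg_series_wp_term x (x + y) (x + (y - 1) / 2) (x + (y + 1) / 2)
  ltac:(by field) cvg1.
have S2 := cvg_series_wp_term (x + 1) (x + 1 + y) (x + 1 + (y - 1) / 2)
  (x + 1 + (y + 1) / 2) ltac:(by field) cvg2.
have S3 := cvg_series_wp_term x (x + y + 1) (x + y / 2) (x + (y + 2) / 2)
  ltac:(by field) cvg3.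
have z0 n : pochhammer (x + y) n != 0 by apply: cvg1.1; rewrite inE eqxx.
have c0 n : pochhammer (x + (y - 1) / 2) n != 0.
  by apply: cvg1.1; rewrite !inE eqxx !orbT.
have uniq (u : nat -> K) (a b : K) :
    u @ \oo --> a -> u @ \oo --> b -> a = b.
  by move=> ua ub; apply: (cvg_unique (@norm_hausdorff _ _) ua ub).
rewrite -(mulrA (x ^+ 3 / _)) -(mulrA (y ^+ 3 / _)); split.
  (* Dropping the empty partial sum keeps the limit, so the limit of the sums up to [n.+1] can be
     computed instead. *)
  have := S1; rewrite -cvg_shiftS => /uniq; apply.
  under eq_fun do rewrite series_wp_termS.
  rewrite (addrAC x y 1) (addrAC x ((y - 1) / 2) 1).
  by apply: cvgB; [exact: cvg_cst | exact: cvgMl_tmp].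
(* With both series on the left, their sum is the limit of the telescoped partial sums. *)
apply/eqP; rewrite -subr_eq opprK; apply/eqP.
apply: (uniq _ _ _ (cvgD S1 (cvgMl_tmp (a := y ^+ 3 / (x + y) ^+ 3) S3))).
rewrite [X in X @ _](funext (fun n => series_wp_term_telescope x y n z0)).
rewrite -[X in _ --> X]subr0 -[X in _ --> _ - X](mul0r 2^-1).
apply: cvgB; first exact: cvg_cst.
(* The remainder has the same ratios [r n] as the first series, whose terms tend to [0] by
   convergence. *)
apply: cvgMr_tmp; apply: wp_term_cvg0 archi (pochhammer_neq0 _ c0) _.
by apply: cvg_series_cvg_0; apply/cvg_ex; eexists; exact: S1.
Qed.

(** The norm lies in [R[i]] with zero imaginary part, so the Archimedean bound in [R] for its real
    part suffices. *)
Lemma complex_norm_ltn {R : realType} (z : R[i]) : exists N, `|z| < N%:R.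
Proof.
exists (Num.bound (complex.Re `|z|)).
have -> : `|z| = ((complex.Re `|z|)%:C)%C by rewrite normc_def.
rewrite -(rmorph_nat (real_complex R)) ltcR /= archi_boundP //.
by case: z => a b; exact: sqrtr_ge0.
Qed.

Theorem theorem10 (R : realType) (x y : R[i])
  (cvg1 : hyper_cvg
     [:: x; x; x; x + (y + 1) / 2; 1]
     [:: x + y; x + y; x + y; x + (y - 1) / 2] (-1))
  (cvg2 : hyper_cvg
     [:: x + 1; x + 1; x + 1; x + 1 + (y + 1) / 2; 1]
     [:: x + 1 + y; x + 1 + y; x + 1 + y; x + 1 + (y - 1) / 2] (-1))
  (cvg3 : hyper_cvg
     [:: x; x; x; x + (y + 2) / 2; 1]
     [:: x + y + 1; x + y + 1; x + y + 1; x + y / 2] (-1)) :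
  (x + (y - 1) / 2)
    * hyperF [:: x; x; x; x + (y + 1) / 2; 1]
             [:: x + y; x + y; x + y; x + (y - 1) / 2] (-1)
  = x + (y - 1) / 2
    - x ^+ 3 / (x + y) ^+ 3 * (x + 1 + (y - 1) / 2)
      * hyperF [:: x + 1; x + 1; x + 1; x + 1 + (y + 1) / 2; 1]
               [:: x + 1 + y; x + 1 + y; x + 1 + y; x + 1 + (y - 1) / 2] (-1)
  /\
  (x + (y - 1) / 2)
    * hyperF [:: x; x; x; x + (y + 1) / 2; 1]
             [:: x + y; x + y; x + y; x + (y - 1) / 2] (-1)
  = (x - 1) / 2 + y
    - y ^+ 3 / (x + y) ^+ 3 * (x + y / 2)
      * hyperF [:: x; x; x; x + (y + 2) / 2; 1]
               [:: x + y + 1; x + y + 1; x + y + 1; x + y / 2] (-1).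
Proof. exact: (contiguous_5F4 _ _ complex_norm_ltn cvg1 cvg2 cvg3). Qed.
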